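(* $i(5) \leq \frac{8}{28}$, where for a positive integer $\Delta$ $$i(\Delta) := \inf\Bigl\{\frac{\alpha(G)}{n} ~\Big|~ G\text{ is a triangle-free graph on } n \text{ vertices with maximum degree at most } \Delta\Bigr\}.$$
   Context: All graphs are finite, simple and undirected, with $n \geq 1$ vertices. For a graph $G$, $\alpha(G)$ denotes its independence number, i.e., the size of a maximum independent set in $G$. A graph is triangle-free if it does not contain three pairwise adjacent vertices. *)

(* Defs.v *)
From mathcomp Require Import all_boot all_order all_algebra.
From mathcomp Require Import all_classical all_reals.

Set Implicit Arguments.
Unset Strict Implicit.
Unset Printing Implicit Defensive.

Import Order.TTheory GRing.Theory Num.Theory.

Local Open Scope classical_set_scope.
Local Open Scope ring_scope.

(* The vertex set may be empty here; the bound n >= 1 is imposed in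
   [independence_ratios]. *)
Record sgraph := SGraph {
  vertex : finType;
  adj : rel vertex;
  adj_sym : symmetric adj;
  adj_irrefl : irreflexive adj }.

Definition num_vertices (G : sgraph) : nat := #|vertex G|.

Definition degree (G : sgraph) (x : vertex G) : nat := #|[set y | adj x y]%SET|.

Definition max_degree (G : sgraph) : nat := (\max_(x : vertex G) degree x)%N.

Definition triangle_free (G : sgraph) : Prop :=
  forall x y z : vertex G, ~ [/\ adj x y, adj y z & adj x z].

Definition independent (G : sgraph) (S : {set vertex G}) : bool :=
  [forall x in S, forall y in S, ~~ adj x y].

Definition independence_number (G : sgraph) : nat :=
  (\max_(S : {set vertex G} | independent S) #|S|)%N.

Definition independence_ratios (R : realType) (Delta : nat) : set R :=
  [set r | exists G : sgraph,
     [/\ (0 < num_vertices G)%N, triangle_free G, (max_degree G <= Delta)%N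
       & r = (independence_number G)%:R / (num_vertices G)%:R]].

Arguments independence_ratios : clear implicits.

Definition inf_ratio (R : realType) (Delta : nat) : R :=
  inf (independence_ratios R Delta).

Arguments inf_ratio : clear implicits.

(* [inf] takes the default value 0 on sets without an infimum; this does not
   happen here. *)
Lemma has_inf_independence_ratios (R : realType) (Delta : nat) :
  has_inf (independence_ratios R Delta).
Proof.
split; last first.
  by exists 0 => _ [G [_ _ _ ->]]; rewrite divr_ge0 ?ler0n.
pose G := @SGraph unit (fun _ _ => false) (fun _ _ => erefl) (fun _ => erefl).
exists ((independence_number G)%:R / (num_vertices G)%:R), G; split=> //.
- by rewrite /num_vertices card_unit.
- by move=> x y z [].
- by apply/bigmax_leqP => x _; rewrite /degree eq_card0 // => y; rewrite inE.
Qed.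

(* Main.v *)
Require Import Defs.
From mathcomp Require Import all_boot all_order all_algebra.
From mathcomp Require Import all_classical all_reals.

Import Order.TTheory GRing.Theory Num.Theory.

Local Open Scope ring_scope.

(** The bound is witnessed by a 5-regular Cayley graph of the dihedral group of
    order 28, found by computer search. Its vertices [(o, p, c)] form two
    orbits [o], each consisting of seven antipodal pairs indexed by [p] in Z/7;
    an antipodal pair is an edge, and the two orbits are joined by a 4-regular
    bipartite graph. An independent set [S] picks at most one vertex of each
    pair, and it avoids a pair of the second orbit as soon as both its ends have
    a neighbour in the part of [S] in the first orbit. So [#|S|] is bounded by a
    function of that part, which takes at most 3^7 values. *)

Definition dvertex : finType := (bool * 'Z_7 * bool)%type.

Definition shifts : seq nat := [:: 0; 1; 3; 6]%N.

(** A signed 2-lift of the circulant bipartite graph on Z/7 with differences 0, 1, 3, 6, where only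
    the difference 6 swaps the sign. *)
Definition cross_adj (p q : 'Z_7) (c e : bool) : bool :=
  has (fun k => (p == q + k%:R) && (c == e (+) (k == 6)%N)) shifts.

Definition dadj (x y : dvertex) : bool :=
  let: (o, p, c) := x in let: (o', q, e) := y in
  match o, o' with
  | false, true => cross_adj p q c e
  | true, false => cross_adj q p e c
  | _, _ => (p == q) && (c != e)
  end.

Lemma dadj_sym : symmetric dadj.
Proof.
by move=> [[[] p] c] [[[] q] e] //=; rewrite eq_sym [c == e]eq_sym.
Qed.

Lemma dadj_irrefl : irreflexive dadj.
Proof. by move=> [[[] p] c] /=; rewrite !eqxx. Qed.

Definition dgraph : sgraph := SGraph dadj_sym dadj_irrefl.

Lemma num_vertices_dgraph : num_vertices dgraph = 28.
Proof. by rewrite /num_vertices !card_prod card_bool card_ord. Qed.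

(* The shifts are distinct mod 7, so [p] and [q] determine the sign. *)
Lemma cross_adj_parity (p q : 'Z_7) (c e c' e' : bool) :
  cross_adj p q c e -> cross_adj p q c' e' -> c (+) e = c' (+) e'.
Proof.
move=> /hasP[k kD /andP[/eqP-> /eqP->]] /hasP[l lD /andP[]].
rewrite (inj_eq (addrI q)) => kl /eqP->.
rewrite addbAC addbb [RHS]addbAC addbb; move: kl.
by move: kD lD; rewrite !inE => /or4P[]/eqP-> /or4P[]/eqP->.
Qed.

(** Among three vertices two share an orbit and, if adjacent, form an antipodal pair; by
    [cross_adj_parity] no vertex of the other orbit sees both ends, and one orbit alone induces a
    matching. *)
Lemma triangle_free_dgraph : triangle_free dgraph.
Proof.
have injl p q c e g : cross_adj p q c g -> cross_adj p q e g -> c = e.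
  by move=> h /(cross_adj_parity _ _ _ _ _ _ h)/addIb.
have injr p q c e g : cross_adj p q g c -> cross_adj p q g e -> c = e.
  by move=> h /(cross_adj_parity _ _ _ _ _ _ h)/addbI.
move=> [[[] p] c] [[[] q] e] [[[] r] g] [] /= h1 h2 h3.
- by move: h1 h2 h3 => /andP[_ +] /andP[_ +] /andP[_]; case: c e g => [] [] [].
- by case/andP: h1 h2 h3 => /eqP<- /eqP ce /injr h /h/esym.
- by case/andP: h3 h1 h2 => /eqP<- /eqP cg /injr h /h.
- by case/andP: h2 h1 h3 => /eqP<- /eqP eg /injl h /h.
- by case/andP: h2 h1 h3 => /eqP<- /eqP eg /injr h /h.
- by case/andP: h3 h1 h2 => /eqP<- /eqP cg /injl h /h.
- by case/andP: h1 h2 h3 => /eqP<- /eqP ce /injl h /h/esym.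
- by move: h1 h2 h3 => /andP[_ +] /andP[_ +] /andP[_]; case: c e g => [] [] [].
Qed.

Lemma max_degree_dgraph : (max_degree dgraph <= 5)%N.
Proof.
apply/bigmax_leqP => -[[o p] c] _.
(* The sign swap is an involution, so only the translation by [k] depends on the orbit. *)
pose nb : seq dvertex := (o, p, ~~ c) ::
  [seq (~~ o, if o then p + k%:R else p - k%:R, c (+) (k == 6)%N) | k <- shifts].
apply: (@leq_trans (size nb)); last by [].
apply: leq_trans (card_size nb); apply/subset_leq_card/fintype.subsetP.
move=> [[o' q] e]; rewrite inE /= => xy.
rewrite {}/nb; case: o o' xy => [] [] xy; rewrite in_cons.
- by case/andP: xy => /eqP->; case: c e => [] [] // _; rewrite eqxx.
- case/hasP: xy => k kD /andP[/eqP-> /eqP->]; apply/orP; right.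
  by apply/mapP; exists k.
- case/hasP: xy => k kD /andP[/eqP-> /eqP->]; apply/orP; right.
  by apply/mapP; exists k; rewrite //= addrK -addbA addbb addbF.
- by case/andP: xy => /eqP->; case: c e => [] [] // _; rewrite eqxx.
Qed.

(* A letter is the trace of [S] on an antipodal pair of the first orbit, and a
   word lists the seven traces. *)
Definition letters : seq (bool * bool) :=
  [:: (false, false); (true, false); (false, true)].

Definition words (n : nat) : seq (seq (bool * bool)) :=
  iter n (fun ws => [seq l :: w | l <- letters, w <- ws]) [:: [::]].

Lemma mem_words (w : seq (bool * bool)) :
  all (mem letters) w -> w \in words (size w).
Proof.
elim: w => [//|l w IHw] /andP[lP wP]; rewrite /words iterS.
by apply/allpairsP; exists (l, w); split=> //; apply: IHw.
Qed.

Definition letter_at (w : seq (bool * bool)) (i : nat) : bool * bool :=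
  nth (false, false) w (i %% 7).

Definition coord (l : bool * bool) (c : bool) : bool := if c then l.2 else l.1.

Definition hit (w : seq (bool * bool)) (i : nat) (e : bool) : bool :=
  has (fun k => coord (letter_at w (i + k)) (e (+) (k == 6)%N)) shifts.

(** Bounds the share of [S] in the two pairs of index [i], one per orbit: the last term allows one
    vertex of the second pair unless both its ends are hit. *)
Definition weight (w : seq (bool * bool)) (i : nat) : nat :=
  coord (letter_at w i) false + coord (letter_at w i) true
  + ~~ (hit w i false && hit w i true).

Lemma word_weight_le8 :
  all (fun w => sumn [seq weight w i | i <- iota 0 7] <= 8)%N (words 7).
Proof. by vm_compute. Qed.

Lemma independence_number_dgraph : (independence_number dgraph <= 8)%N.
Proof.
apply/bigmax_leqP => S indS.
have nadj x y : x \in S -> y \in S -> ~~ dadj x y.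
  move=> xS yS; move/forallP/(_ x): indS; rewrite xS /=.
  by move/forallP/(_ y); rewrite yS.
pose inS o c i : bool := (o, i%:R : 'Z_7, c) \in S.
pose w := mkseq (fun i => (inS false false i, inS false true i)) 7.
have excl o i : ~~ (inS o false i && inS o true i).
  apply/negP => /andP[h1 h2]; move/negP: (nadj _ _ h1 h2); apply.
  by rewrite /=; case: (o); rewrite eqxx.
have wP : w \in words 7.
  apply: (mem_words w); apply/allP => _ /mapP[i _ ->].
  by have := excl false i; case: (inS _ _ _); case: (inS _ _ _).
have coordE i c : coord (letter_at w i) c = inS false c i.
  rewrite /letter_at nth_mkseq ?ltn_mod // /inS Zp_nat_mod //.
  by case: c.
have hitP i e : hit w i e -> ~~ inS true e i.
  move=> /hasP[k kD]; rewrite coordE => h1; apply/negP => h2.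
  move/negP: (nadj _ _ h1 h2); apply; apply/hasP; exists k => //.
  by rewrite natrD !eqxx.
apply: leq_trans (allP word_weight_le8 w wP).
(* Summing over [p] outermost puts both pairs of index [p] in one summand, to be compared with one
   [weight]. *)
have -> : #|S| = (\sum_(p : 'Z_7) \sum_o \sum_c ((o, p, c) \in S))%N.
  rewrite exchange_big pair_bigA pair_bigA -sum1_card big_mkcond /=.
  by apply: eq_bigr => -[[o p] c] _ /=; case: ifP.
rewrite sumnE big_map -[iota 0 7]/(index_iota 0 7) big_mkord.
apply: leq_sum => p _.
have inSE o c : (o, p, c) \in S = inS o c p by rewrite /inS natr_Zp.
under eq_bigr do under eq_bigr do rewrite inSE.
rewrite !big_bool /= /weight !coordE addnC; apply: leq_add.
  by rewrite addnC.
case: (hit w p false) (hitP p false) => [/(_ isT)/negbTE->|_].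
  case: (hit w p true) (hitP p true) => [/(_ isT)/negbTE->|_] //.
  by case: (inS _ _ _).
by move: (excl true p); case: (inS _ _ _); case: (inS _ _ _).
Qed.

Theorem mainTheorem1 (R : realType) : inf_ratio R 5 <= 8%:R / 28%:R.
Proof.
apply: (@le_trans _ _ ((independence_number dgraph)%:R / 28%:R)).
  apply: ge_inf; first exact: (has_inf_independence_ratios R 5).2.
  exists dgraph; rewrite num_vertices_dgraph; split=> //.
  - exact: triangle_free_dgraph.
  - exact: max_degree_dgraph.
by rewrite ler_pM2r ?invr_gt0 ?ltr0n // ler_nat independence_number_dgraph.
Qed.
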